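(* Let $k\ge2$ be an integer and $c\in(0,1)$. Let $(M_n)_{n\ge1}$ be integers with $1\le M_n\le kn-1$ and $M_n/(kn)\to c$ as $n\to\infty$. Then \[ \lim_{n\to\infty} P_{n,k}(\mathcal{S}(n,k;M_n))=-(1-c)^k\sum_{l=1}^{k-1}\binom kl\Big(\frac c{1-c}\Big)^l\frac l{k-l} +k\sum_{l=1}^{k-1}\binom kl c^l\int_0^{1-c}\frac{y^{k-l-1}}{1-y^k}\,dy-c^k\log\big(1-(1-c)^k\big). \]
   Context: Fix integers $k\ge2$, $n\ge1$. There are $kn$ items, $k$ items at each of the ranks $1,2,\dots,n$ (rank $n$ is highest). The items are revealed one at a time in a uniformly random order, i.e. the sequence of ranks is a uniformly random permutation of the multiset $\{1^k,2^k,\dots,n^k\}$; $P_{n,k}$ denotes this uniform probability. For $M\in\{1,\dots,kn-1\}$, the strategy $\mathcal{S}(n,k;M)$ lets the first $M$ items pass and then selects the first later-arriving item whose rank is greater than or equal to the highest rank among the first $M$ items (if such an item exists; otherwise nothing is selected). $P_{n,k}(\mathcal{S}(n,k;M))$ denotes the probability that this strategy selects an item of rank $n$. *)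

(* Defs.v *)
From HB Require Import structures.
From mathcomp Require Import all_boot all_order all_algebra.
From mathcomp Require Import all_classical all_reals all_analysis.
Set Implicit Arguments. Unset Strict Implicit. Unset Printing Implicit Defensive.
Import Order.TTheory GRing.Theory Num.Theory.

(* Ranks 1..n are encoded 0-indexed as 'I_n (rank r+1 <-> r); the order of
   arrival positions 1..kn is encoded as 'I_(k*n). A realization of the
   random order is a map s : position -> rank in which every rank occurs
   exactly k times (a word of the multiset {1^k,...,n^k}); P_{n,k} is the
   uniform distribution on these words. *)
Definition arrangements (n k : nat) : {set {ffun 'I_(k * n) -> 'I_n}} :=
  [set s : {ffun 'I_(k * n) -> 'I_n} | [forall r : 'I_n, #|[set i : 'I_(k * n) | s i == r]| == k]].

(* Strategy S(n,k;M): let the first M items pass (positions i < M), let m be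
   the highest rank among them, and select the first later item (position
   j >= M) whose rank is >= m. Success = the selected item has rank n
   (encoded n.-1). *)
Definition max_first (n k M : nat) (s : {ffun 'I_(k * n) -> 'I_n}) : nat :=
  \max_(i < k * n | (i < M)%N) (s i : nat).

Definition selects_top (n k M : nat) (s : {ffun 'I_(k * n) -> 'I_n}) : bool :=
  [exists j : 'I_(k * n),
     [&& (M <= j)%N, (max_first M s <= s j)%N,
         [forall i : 'I_(k * n), ((M <= i)%N && (i < j)%N) ==> (s i < max_first M s)%N]
       & (s j == n.-1 :> nat)]].

Definition Psucc (R : realType) (n k M : nat) : R :=
  (#|[set s in arrangements n k | selects_top M s]|%:R / #|arrangements n k|%:R)%R.

(* Main.v *)
Require Import Defs.
From HB Require Import structures.
From mathcomp Require Import all_boot all_order all_algebra.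
From mathcomp Require Import all_classical all_reals all_analysis.
From mathcomp Require Import perm zify ring lra.
Set Implicit Arguments. Unset Strict Implicit. Unset Printing Implicit Defensive.
Import Order.TTheory GRing.Theory Num.Theory.
Import numFieldNormedType.Exports.

(* Let j be the number of ranks above the maximum of the first M items, and l the number of copies
   of that maximum among these M items.  Exchanging an early item with a late one, in all possible
   ways, compares the number of arrangements of type (j, l) with that of type (j, l + 1); summing
   over l compares the arrangements whose top j ranks are late with those whose top j + 1 ranks are
   late, and in the limit type (j, l) has probability C(k, l) c^l (1 - c)^(k - l + j k).
   Exchanging the selected item with any other candidate shows that, given the type, each of the
   j k + k - l candidates is equally likely to be selected, so the success probability is
   k / (j k + k - l) for j > 0, and it is 1 for j = 0 and l < k.  The types with j >= J have total
   probability tending to (1 - c)^(k J), so the limits may be summed over j; integrating a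
   geometric series termwise identifies the sum. *)

(** * Exchanges of two positions, and the classification of words by early maximum *)

Notation word n k := {ffun 'I_(k * n) -> 'I_n}.

Definition swap (n k : nat) (s : word n k) (p q : 'I_(k * n)) : word n k :=
  [ffun i => s (tperm p q i)].

Definition early (n k M r : nat) (s : word n k) : nat :=
  \sum_(i < k * n | i < M) (s i == r :> nat).

Definition below (n k M m : nat) (s : word n k) : bool :=
  [forall i : 'I_(k * n), (i < M) ==> (s i < m)].

Definition below_set (n k M m : nat) : {set word n k} :=
  [set s in arrangements n k | below M m s].

(** The value [l = 0] is allowed on purpose. For [l > 0] the early maximum is [r], while for [l = 0]
    it lies strictly below [r]; this is what permits a recursion over ranks. *)
Definition level (n k M r l : nat) : {set word n k} :=
  [set s in below_set n k M r.+1 | early M r s == l].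

Lemma mem_below_set (n k M m : nat) (s : word n k) :
  (s \in below_set n k M m) = (s \in arrangements n k) && below M m s.
Proof. by rewrite finset.in_set. Qed.

Lemma mem_level (n k M r l : nat) (s : word n k) :
  (s \in level n k M r l) =
  [&& s \in arrangements n k, below M r.+1 s & early M r s == l].
Proof. by rewrite finset.in_set mem_below_set andbA. Qed.

Lemma swapK (n k : nat) (p q : 'I_(k * n)) :
  involutive (fun s : word n k => swap s p q).
Proof. by move=> s; apply/ffunP => i; rewrite !ffunE tpermK. Qed.

(** Double counting: for fixed [p] and [q] the exchange is an involution on words, so it can be used
    to reindex the sum over [s]. *)
Lemma sum_swap (n k : nat) (P Q : word n k -> 'I_(k * n) -> 'I_(k * n) -> bool) :
  (forall s p q, P (swap s p q) p q = Q s p q) ->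
  \sum_s \sum_p \sum_q (P s p q : nat) = \sum_s \sum_p \sum_q (Q s p q : nat).
Proof.
move=> PQ; rewrite exchange_big [RHS]exchange_big; apply: eq_bigr => p _.
rewrite exchange_big [RHS]exchange_big; apply: eq_bigr => q _.
rewrite (reindex_inj (inv_inj (swapK p q))) /=.
by apply: eq_bigr => s _; rewrite PQ.
Qed.

Lemma swap_arrangements (n k : nat) (s : word n k) (p q : 'I_(k * n)) :
  (swap s p q \in arrangements n k) = (s \in arrangements n k).
Proof.
rewrite !inE; apply: eq_forallb => r; congr (_ == _).
rewrite -!sum1_card (reindex_inj (@perm_inj _ (tperm p q))) /=.
by apply: eq_bigl => i; rewrite !inE ffunE tpermK.
Qed.

(** Among the first [M] positions only [p] changes its item. The additive form avoids truncated
    subtraction. *)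
Lemma swap_early (n k M r : nat) (s : word n k) (p q : 'I_(k * n)) :
  p < M <= q ->
  early M r (swap s p q) + (s p == r :> nat) = early M r s + (s q == r :> nat).
Proof.
case/andP=> pM Mq; rewrite /early (bigD1 p) //= [in RHS](bigD1 p) //= ffunE tpermL.
rewrite (eq_bigr (fun i => (s i == r :> nat) : nat)) => [|i /andP[iM ip]]; first by rewrite addnC [X in _ + X]addnC addnA.
by rewrite ffunE tpermD // 1?eq_sym // -val_eqE /= ltn_eqF ?(leq_trans iM Mq).
Qed.

Lemma swap_below (n k M m : nat) (s : word n k) (p q : 'I_(k * n)) :
  p < M <= q -> s p < m -> s q < m -> below M m (swap s p q) = below M m s.
Proof.
case/andP=> pM Mq sp sq; apply: eq_forallb => i; rewrite ffunE.
case: tpermP => // [->|->]; first by rewrite sp sq.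
by rewrite ltnNge Mq.
Qed.

(** * Counting the early and late items of each kind *)

Lemma arrangements_count (n k : nat) (s : word n k) (P : pred nat) :
  s \in arrangements n k ->
  \sum_i (P (s i) : nat) = k * \sum_(v < n) (P v : nat).
Proof.
rewrite inE => /forallP sk.
rewrite (partition_big s predT) //= big_distrr /=; apply: eq_bigr => v _.
under eq_bigr => i /eqP -> do [].
rewrite sum_nat_const; congr (_ * _); rewrite -[RHS](eqP (sk v)) -!sum1_card.
by apply: eq_bigl => i; rewrite !inE.
Qed.

Lemma sum_ord_lt (n r : nat) : r <= n -> \sum_(v < n) ((v < r) : nat) = r.
Proof.
(* Replacing the result by [minn n r] gives a statement valid for every [r], hence fit for induction
   on [n]. *)
move/minn_idPr => {2}<-; elim: n => [|n IH]; first by rewrite big_ord0 min0n.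
by rewrite big_ord_recr /= IH; lia.
Qed.

(** All counts come from complements: there are [M] early positions, [k] copies of [r], [k * r]
    items below [r] and [k * (n - r)] items of rank at least [r]. In the last case the early ones
    are exactly the [l] copies of [r], so the fifth sum counts the candidates for selection. *)
Lemma level_counts (n k M r l : nat) (s : word n k) :
  r < n -> M <= k * n -> s \in level n k M r l ->
  [/\ \sum_(p < k * n) ((p < M) && (s p == r :> nat) : nat) = l,
      \sum_(p < k * n) ((p < M) && (s p < r) : nat) = M - l,
      \sum_(q < k * n) ((M <= q) && (s q == r :> nat) : nat) = k - l,
      \sum_(q < k * n) ((M <= q) && (s q < r) : nat) = k * r - (M - l) &
      \sum_(q < k * n) ((M <= q) && (r <= s q) : nat) = k * (n - r) - l].
Proof.
move=> rn MN; rewrite mem_level => /and3P[sE /forallP sb /eqP sl].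
have e1 : \sum_(p < k * n) ((p < M) && (s p == r :> nat) : nat) = l.
  by rewrite -sl /early [RHS]big_mkcond; apply: eq_bigr => i _; case: (i < M).
have e0 : \sum_(p < k * n) ((p < M) : nat) = M := sum_ord_lt MN.
have e2 : \sum_(p < k * n) ((p < M) && (s p < r) : nat) + l = M.
  rewrite -[RHS]e0 -e1 -big_split /=; apply: eq_bigr => i _.
  by have := sb i; case: (i < M) => //=; rewrite ltnS leq_eqVlt; case: ltngtP.
have e3 : \sum_(q < k * n) ((M <= q) && (s q == r :> nat) : nat) + l = k.
  have ek : \sum_i ((s i == r :> nat) : nat) = k.
    rewrite (arrangements_count (pred1 r) sE) /= (bigD1 (Ordinal rn)) //= eqxx.
    rewrite big1 ?addn0 ?muln1 // => v; rewrite -val_eqE /= => /negPf -> //.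
  rewrite -[RHS]ek -e1 -big_split /=; apply: eq_bigr => i _.
  by rewrite ltnNge; case: (M <= i); rewrite ?addn0.
have e4 : \sum_(q < k * n) ((M <= q) && (s q < r) : nat) + \sum_(p < k * n) ((p < M) && (s p < r) : nat) = k * r.
  rewrite -[in RHS](sum_ord_lt (ltnW rn)) -(arrangements_count (fun v => v < r) sE).
  rewrite -big_split /=; apply: eq_bigr => i _.
  by rewrite [i < M]ltnNge; case: (M <= i); rewrite ?addn0.
have e5 : \sum_(q < k * n) ((M <= q) && (r <= s q) : nat) + l = k * (n - r).
  have en : \sum_(v < n) ((r <= v) : nat) = n - r.
    apply/eqP; rewrite -(eqn_add2r r) subnK ?(ltnW rn) // -[X in _ + X == _](sum_ord_lt (ltnW rn)).
    rewrite -big_split /= (eq_bigr (fun=> 1)) ?sum_nat_const ?card_ord ?muln1 // => v _.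
    by rewrite ltnNge; case: leqP.
  rewrite -[in RHS]en -(arrangements_count (fun v => r <= v) sE) -e1 -big_split /=.
  apply: eq_bigr => i _; have := sb i; rewrite [i < M]ltnNge; case: (M <= i) => /= [_|].
    by rewrite addn0.
  by rewrite ltnS; case: ltngtP.
by split=> //; lia.
Qed.

(** * Comparison of successive levels *)

Lemma sum_level (n k M r l c : nat) (F : word n k -> nat) :
  (forall s, s \in level n k M r l -> F s = c) ->
  \sum_(s in level n k M r l) F s = #|level n k M r l| * c.
Proof. by move=> H; rewrite (eq_bigr (fun=> c)) // sum_nat_const. Qed.

Lemma sum_andb_mul (I J : finType) (P : pred I) (Q : pred J) :
  \sum_i \sum_j (P i && Q j : nat) = (\sum_i (P i : nat)) * (\sum_j (Q j : nat)).
Proof.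
rewrite big_distrl /=; apply: eq_bigr => i _; rewrite big_distrr /=.
by apply: eq_bigr => j _; rewrite mulnb.
Qed.

(** Both sides count triples of a word, an early position and a late position. Exchanging an early
    copy of [r] with a late item below [r] turns a word with [l.+1] early copies into one with [l],
    and the same exchange undoes this. *)
Lemma level_step (n k M r l : nat) :
  r < n -> M <= k * n ->
  #|level n k M r l.+1| * (l.+1 * (k * r - (M - l.+1))) =
  #|level n k M r l| * ((M - l) * (k - l)).
Proof.
move=> rn MN.
pose P (t : nat) (s : word n k) (p q : 'I_(k * n)) (a b : bool) :=
  (s \in level n k M r t) && (((p < M) && a) && ((M <= q) && b)).
have -> : #|level n k M r l.+1| * (l.+1 * (k * r - (M - l.+1))) =
  \sum_s \sum_p \sum_q (P l.+1 s p q (s p == r :> nat) (s q < r) : nat).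
  rewrite -(@sum_level _ _ _ _ _ _ (fun s : word n k => \sum_(p < k * n) \sum_(q < k * n)
     (((p < M) && (s p == r :> nat)) && ((M <= q) && (s q < r)) : nat))).
    rewrite big_mkcond; apply: eq_bigr => s _; rewrite /P; case: ifP => //= _.
    by rewrite big1 // => p _; rewrite big1.
  move=> s /(level_counts rn MN)[e1 _ _ e4 _].
  by rewrite (sum_andb_mul (fun p : 'I_(k * n) => (p < M) && (s p == r :> nat))) e1 e4.
have -> : #|level n k M r l| * ((M - l) * (k - l)) =
  \sum_s \sum_p \sum_q (P l s p q (s p < r) (s q == r :> nat) : nat).
  rewrite -(@sum_level _ _ _ _ _ _ (fun s : word n k => \sum_(p < k * n) \sum_(q < k * n)
     (((p < M) && (s p < r)) && ((M <= q) && (s q == r :> nat)) : nat))).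
    rewrite big_mkcond; apply: eq_bigr => s _; rewrite /P; case: ifP => //= _.
    by rewrite big1 // => p _; rewrite big1.
  move=> s /(level_counts rn MN)[_ e2 e3 _ _].
  by rewrite (sum_andb_mul (fun p : 'I_(k * n) => (p < M) && (s p < r))) e2 e3.
apply: sum_swap => s p q; rewrite /P !ffunE tpermL tpermR.
case: (ltnP p M) => pM; last by rewrite !andbF.
case: (leqP M q) => Mq; last by rewrite !andbF.
rewrite /= [(s p < r) && _]andbC.
case: (eqVneq (s q : nat) r) => sq; last by rewrite !andbF.
case: (ltnP (s p) r) => sp; last by rewrite !andbF.
have pq : p < M <= q by rewrite pM.
rewrite !andbT !mem_level swap_arrangements swap_below ?sq ?ltnS ?(ltnW sp) //.
have := swap_early r s pq; rewrite sq eqxx (ltn_eqF sp) addn0 addn1 => ->.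
by rewrite eqSS.
Qed.

(** * The selected item *)

Definition first_at (n k M r : nat) (s : word n k) (q : 'I_(k * n)) : bool :=
  [&& M <= q, r <= s q & [forall i : 'I_(k * n), (M <= i) && (i < q) ==> (s i < r)]].

Lemma max_first_level (n k M r l : nat) (s : word n k) :
  0 < l -> s \in level n k M r l -> max_first M s = r.
Proof.
move=> l0; rewrite mem_level => /and3P[_ /forallP sb /eqP sl].
apply/eqP; rewrite eqn_leq; apply/andP; split.
  by apply/bigmax_leqP => i iM; have /implyP/(_ iM) := sb i.
have [i /andP[iM /eqP <-]|no] := pickP (fun i : 'I_(k * n) => (i < M) && (s i == r :> nat)).
  exact: (bigop.bigmax_sup i).
move: l0; rewrite -sl /early big1 // => i iM.
by have := no i; rewrite iM /= => ->.
Qed.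

Lemma sum_unique (T : finType) (P : pred T) :
  (forall x y, P x -> P y -> x = y) -> \sum_x (P x : nat) = [exists x, P x].
Proof.
move=> uP; case: existsP => [[x Px]|nP].
  rewrite (bigD1 x) //= Px big1 // => y; case Py: (P y) => //.
  by rewrite (uP _ _ Py Px) eqxx.
by rewrite big1 // => x _; case Px: (P x) => //; case: nP; exists x.
Qed.

Lemma first_at_unique (n k M r : nat) (s : word n k) (p q : 'I_(k * n)) :
  first_at M r s p -> first_at M r s q -> p = q.
Proof.
move=> /and3P[Mp rp /forallP fp] /and3P[Mq rq /forallP fq]; apply: val_inj => /=.
case: (ltngtP p q) => // [pq|qp].
  by have := fq p; rewrite Mp pq /= ltnNge rp.
by have := fp q; rewrite Mq qp /= ltnNge rq.
Qed.

Lemma first_at_exists (n k M r : nat) (s : word n k) (p : 'I_(k * n)) :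
  M <= p -> r <= s p -> exists q, first_at M r s q.
Proof.
move=> Mp rp; have Pp : (M <= p) && (r <= s p) by rewrite Mp.
case: (arg_minnP (P := fun i : 'I_(k * n) => (M <= i) && (r <= s i)) (fun i => i : nat) Pp).
move=> q /andP[Mq rq] qmin; exists q; apply/and3P; split=> //.
apply/forallP => i; apply/implyP => /andP[Mi iq]; rewrite ltnNge.
by apply/negP => ri; have := qmin i; rewrite Mi ri leqNgt iq => /(_ isT).
Qed.

Lemma swap_level (n k M r l : nat) (s : word n k) (p q : 'I_(k * n)) :
  M <= p -> M <= q ->
  (swap s p q \in level n k M r l) = (s \in level n k M r l).
Proof.
move=> Mp Mq; have E (i : 'I_(k * n)) : i < M -> swap s p q i = s i.
  by move=> iM; rewrite ffunE tpermD // -val_eqE /= gtn_eqF ?(leq_trans iM).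
rewrite !mem_level swap_arrangements; congr [&& _, _ & _].
  by apply: eq_forallb => i; case iM: (i < M) => //=; rewrite E.
by rewrite /early; under eq_bigr => i iM do rewrite (E i iM).
Qed.

(** If [p < q], then position [p] holds a candidate before [q] in both words, so both sides are
    false; otherwise nothing before [q] is moved. *)
Lemma swap_first_at (n k M r : nat) (s : word n k) (p q : 'I_(k * n)) :
  M <= p -> r <= s p -> r <= s q ->
  first_at M r (swap s p q) q = first_at M r s q.
Proof.
move=> Mp rp rq; rewrite /first_at ffunE tpermR rp rq /=; congr (_ && _).
case: (ltnP p q) => pq.
  transitivity false; first by apply/forallP => /(_ p); rewrite Mp pq ffunE tpermL ltnNge rq.
  by apply/esym/forallP => /(_ p); rewrite Mp pq ltnNge rp.
apply: eq_forallb => i; case: (ltnP i q) => iq; last by rewrite andbF.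
by rewrite ffunE tpermD // -val_eqE /= gtn_eqF // (leq_trans iq).
Qed.

(** When [r] is the top rank, [l] of its [k] copies are early; otherwise the top rank exceeds every
    early item and all its copies are late. *)
Lemma late_top_count (n k M r l : nat) (s : word n k) :
  r < n -> M <= k * n -> s \in level n k M r l ->
  \sum_(p < k * n) ((M <= p) && (s p == n.-1 :> nat) : nat) =
  if r.+1 == n then k - l else k.
Proof.
move=> rn MN sl; case: eqP => [rn1|/eqP rn1].
  have -> : n.-1 = r by lia.
  by have [_ _ -> _ _] := level_counts rn MN sl.
move: sl; rewrite mem_level => /and3P[sE /forallP sb _].
have n1 : n.-1 < n by lia.
transitivity (\sum_i (pred1 n.-1 (s i : nat) : nat)).
  apply: eq_bigr => i _; case: (leqP M i) => //= iM.
  have /implyP/(_ iM) := sb i; case: eqP => //; lia.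
rewrite (arrangements_count (pred1 n.-1) sE) (bigD1 (Ordinal n1)) //= eqxx big1 ?muln1 //.
by move=> v; rewrite -val_eqE /= => /negPf ->.
Qed.

Lemma selects_top_level (n k M r l : nat) (s : word n k) :
  0 < l -> s \in level n k M r l ->
  \sum_q (first_at M r s q && (s q == n.-1 :> nat) : nat) = selects_top M s.
Proof.
move=> l0 sl; rewrite (sum_unique (P := fun q => first_at M r s q && (s q == n.-1 :> nat))).
  rewrite /selects_top (max_first_level l0 sl); congr (nat_of_bool _).
  by apply: eq_existsb => q; rewrite /first_at -!andbA.
by move=> p q /andP[+ _] /andP[+ _]; apply: first_at_unique.
Qed.

(* Exchanging the selected item with an arbitrary candidate shows that every candidate is equally
   likely to come first. *)
Lemma level_select (n k M r l : nat) :
  r < n -> M <= k * n -> 0 < l ->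
  #|[set s in level n k M r l | selects_top M s]| * (k * (n - r) - l) =
  #|level n k M r l| * (if r.+1 == n then k - l else k).
Proof.
move=> rn MN l0.
(* [P] pairs a successful word, with selection at [q], with an arbitrary candidate [p]; [Q] pairs a
   late top item at [p] with the position [q] of the selection. Exchanging [p] and [q] carries one
   to the other. *)
pose P (s : word n k) (p q : 'I_(k * n)) :=
  (s \in level n k M r l) &&
  (((M <= p) && (r <= s p)) && (first_at M r s q && (s q == n.-1 :> nat))).
pose Q (s : word n k) (p q : 'I_(k * n)) :=
  (s \in level n k M r l) &&
  (((M <= p) && (s p == n.-1 :> nat)) && first_at M r s q).
have -> : #|[set s in level n k M r l | selects_top M s]| * (k * (n - r) - l) =
    \sum_s \sum_p \sum_q (P s p q : nat).
  rewrite -sum_nat_const (eq_bigl (fun s => (s \in level n k M r l) && selects_top M s)); last first.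
    by move=> s; rewrite finset.in_set.
  rewrite big_mkcond; apply: eq_bigr => s _; rewrite /P.
  case sl: (s \in _) => /=; last by rewrite big1 // => p _; rewrite big1.
  rewrite (sum_andb_mul (fun p : 'I_(k * n) => (M <= p) && (r <= s p))
    (fun q : 'I_(k * n) => first_at M r s q && (s q == n.-1 :> nat))).
  rewrite (selects_top_level l0 sl); have [_ _ _ _ ->] := level_counts rn MN sl.
  by case: selects_top; rewrite ?muln1 ?muln0.
have -> : #|level n k M r l| * (if r.+1 == n then k - l else k) =
    \sum_s \sum_p \sum_q (Q s p q : nat).
  rewrite -sum_nat_const big_mkcond; apply: eq_bigr => s _; rewrite /Q.
  case sl: (s \in _) => /=; last by rewrite big1 // => p _; rewrite big1.
  rewrite (sum_andb_mul (fun p : 'I_(k * n) => (M <= p) && (s p == n.-1 :> nat))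
    (first_at M r s)) (sum_unique (@first_at_unique n k M r s)) -(late_top_count rn MN sl).
  (* A late top item is itself a candidate, so a selection exists; without one, both sides
     vanish. *)
  have [p /andP[Mp /eqP sp]|no] :=
    pickP (fun p : 'I_(k * n) => (M <= p) && (s p == n.-1 :> nat)).
    have -> : [exists q, first_at M r s q]; last by rewrite muln1.
    by apply/existsP; apply: (first_at_exists Mp); rewrite sp; lia.
  by rewrite big1 // => p _; have := no p => /= ->.
apply: sum_swap => s p q; rewrite /P /Q ffunE tpermL.
case: (leqP M p) => Mp; last by rewrite !andbF.
case: (leqP M q) => Mq; last by rewrite /first_at [M <= q]leqNgt Mq !andbF.
rewrite swap_level // ffunE tpermR /=; congr (_ && _).
case: (eqVneq (s p : nat) n.-1) => sp /=; last by rewrite !andbF.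
have rp : r <= s p by rewrite sp; lia.
case: (leqP r (s q)) => rq /=; first by rewrite swap_first_at // andbT.
by rewrite /first_at [r <= s q]leqNgt rq !andbF.
Qed.

(** * Decomposition by the number of early copies *)

Lemma early_le (n k M r : nat) (s : word n k) :
  r < n -> s \in arrangements n k -> early M r s <= k.
Proof.
move=> rn sE; rewrite /early big_mkcond /=.
apply: (@leq_trans (\sum_i (pred1 r (s i : nat) : nat))).
  by apply: leq_sum => i _; case: (i < M).
rewrite (arrangements_count (pred1 r) sE) (bigD1 (Ordinal rn)) //= eqxx big1 ?muln1 //.
by move=> v; rewrite -val_eqE /= => /negPf ->.
Qed.

(** The event [E] is kept general so that the same partition serves both for all words and for the
    successful ones. *)
Lemma below_set_split (n k M r : nat) (E : pred (word n k)) :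
  r < n ->
  #|[set s in below_set n k M r.+1 | E s]| =
  \sum_(l < k.+1) #|[set s in level n k M r l | E s]|.
Proof.
move=> rn; under eq_bigr do rewrite -sum1_card big_mkcond.
rewrite exchange_big -sum1_card big_mkcond; apply: eq_bigr => s _.
rewrite finset.in_set; under eq_bigr do rewrite finset.in_set mem_level.
rewrite mem_below_set; case sE: (s \in _) => /=; last by rewrite big1.
have lk : early M r s < k.+1 by rewrite ltnS early_le.
case: below => /=; last by rewrite big1.
rewrite (bigD1 (Ordinal lk)) //= eqxx big1 ?addn0 // => l.
by rewrite -val_eqE /= eq_sym => /negPf ->.
Qed.

Lemma level0 (n k M r : nat) : level n k M r 0 = below_set n k M r.
Proof.
apply/setP => s; rewrite mem_level mem_below_set; congr (_ && _).
rewrite /early sum_nat_eq0; apply/andP/forallP => [[/forallP sb /forallP s0] i|sb].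
  apply/implyP => iM; have /implyP/(_ iM) := sb i; have /implyP/(_ iM) := s0 i.
  by rewrite ltnS eqb0 leq_eqVlt; case: eqP.
split; apply/forallP => i; apply/implyP => iM; have /implyP/(_ iM) := sb i.
  exact: ltnW.
by rewrite eqb0 => /ltn_eqF ->.
Qed.

(** The vectorisation of [k] by [n] matrices identifies positions with pairs of a copy number and a
    rank; the rank component is an arrangement. *)
Lemma arrangements_gt0 (n k : nat) : 0 < #|arrangements n k|.
Proof.
have [g gK Kg] := curry_mxvec_bij k n.
have gE (i : 'I_k) (r : 'I_n) : g (mxvec_index i r) = (i, r) by exact: (gK (i, r)).
apply/card_gt0P; exists [ffun i => (g i).2]; rewrite inE; apply/forallP => r.
apply/eqP; rewrite -[RHS]card_ord.
rewrite -(card_imset predT (f := fun i : 'I_k => mxvec_index i r)).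
  apply: eq_card => i; rewrite inE ffunE; apply/eqP/imsetP => [<-|[j _ ->]].
    by exists (g i).1 => //; rewrite -[LHS]Kg //; case: (g i).
  by rewrite gE.
by move=> i j /= /(congr1 g); rewrite !gE => -[].
Qed.

(** All [k] top items have passed. This case is separate because the candidate count
    [k * (n - r) - k] is then zero and [level_select] reads [0 = 0]. *)
Lemma level_full_select (n k M r : nat) :
  r.+1 = n -> M <= k * n -> [set s in level n k M r k | selects_top M s] = finset.set0.
Proof.
move=> rn MN; apply/setP => s; rewrite finset.in_set finset.in_set0.
case sl: (s \in _) => //=; apply/negbTE/existsP => -[q /and4P[Mq _ _ sq]].
have rn' : r < n by rewrite -rn.
have := late_top_count rn' MN sl; rewrite rn eqxx subnn => /eqP.
by rewrite sum_nat_eq0 => /forallP/(_ q); rewrite Mq sq.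
Qed.

Local Open Scope classical_set_scope.
Local Open Scope ring_scope.

(** * Integrals and the series they sum *)

Lemma continuous_within (R : realType) (A : set R) (f : R -> R) :
  (forall x, A x -> {for x, continuous f}) -> {within A, continuous f}.
Proof. by move=> cf; apply: continuous_in_subspaceT => x /set_mem; apply: cf. Qed.

Lemma Rintegral_primitive (R : realType) (f F : R -> R) (x : R) :
  0 < x -> (forall y, y \in `[0, x] -> {for y, continuous f}) ->
  (forall y, y \in `[0, x] -> is_derive y 1 F (f y)) ->
  \int[lebesgue_measure]_(y in `[0, x]) f y = F x - F 0.
Proof.
move=> x0 cf dF; rewrite /Rintegral (@continuous_FTC2 _ _ F) //.
- exact: continuous_within.
- have cF y : y \in `[0, x] -> {for y, continuous F}.
    move=> yx; apply: differentiable_continuous; apply/derivable1_diffP.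
    by case: (dF y yx).
  split.
  + by move=> y yx; case: (dF y (subset_itv_oo_cc yx)).
  + by apply: cvg_at_right_filter; apply: cF; rewrite in_itv /= lexx ltW.
  + by apply: cvg_at_left_filter; apply: cF; rewrite in_itv /= lexx ltW.
- by move=> y yx; rewrite derive1E; case: (dF y (subset_itv_oo_cc yx)).
Qed.

Lemma Rintegral_monomial (R : realType) (p : nat) (x : R) : 0 < x ->
  \int[lebesgue_measure]_(y in `[0, x]) y ^+ p = x ^+ p.+1 / p.+1%:R.
Proof.
move=> x0.
have dF (y : R) : y \in `[0, x] -> is_derive y 1 (horner (p.+1%:R^-1 *: 'X^(p.+1))) (y ^+ p).
  move=> _; apply: is_derive_eq.
  by rewrite derivZ derivXn !hornerE hornerMn hornerXn -(mulr_natl (y ^+ _)) mulrA mulVf ?mul1r // pnatr_eq0.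
rewrite (Rintegral_primitive x0 _ dF) => [|y _]; last exact: exprn_continuous.
by rewrite !hornerE expr0n /= mulr0 subr0 mulrC.
Qed.

Lemma Rintegral_inv_onem (R : realType) (x : R) : 0 < x < 1 ->
  \int[lebesgue_measure]_(y in `[0, x]) (1 - y)^-1 = - ln (1 - x).
Proof.
case/andP=> x0 x1.
have pos y : y \in `[0, x] -> 0 < 1 - y.
  by rewrite in_itv /= => /andP[_ yx]; rewrite subr_gt0 (le_lt_trans yx).
apply: etrans (Rintegral_primitive (F := fun y => - ln (1 - y)) x0 _ _) _.
- move=> y /pos y1; apply: cvgV; first by rewrite gt_eqF.
  by apply: cvgB => //; exact: cvg_cst.
- move=> y /pos y1; have dln := is_derive1_ln y1.
  have dc : is_derive (y : R) (1 : R) (cst 1 - id : R -> R) (0 - 1).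
    exact: (@is_deriveB R R R (cst 1) id y 1 0 1 (is_derive_cst _ _ _) (is_derive_id _ _)).
  have dl := @is_deriveN R R R _ y 1 _ (@is_derive1_comp R (@ln R) (cst 1 - id) y _ _ dln dc).
  by rewrite sub0r mulrN1 opprK in dl.
- by rewrite subr0 ln1 oppr0 subr0.
Qed.

Lemma geometric_kernel_integrable (R : realType) (k m : nat) (x : R) :
  (0 < k)%N -> 0 < x < 1 ->
  lebesgue_measure.-integrable `[0, x]
    (EFin \o (fun y : R => y ^+ m / (1 - y ^+ k))).
Proof.
move=> k0 /andP[x0 x1]; apply: continuous_compact_integrable; first exact: segment_compact.
apply: continuous_within => y; rewrite /= in_itv /= => /andP[y0 yx].
apply: cvgM; first exact: exprn_continuous.
apply: cvgV; last by apply: cvgB; [exact: cvg_cst|exact: exprn_continuous].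
by rewrite subr_eq0 eq_sym lt_eqF // exprn_ilt1 ?(le_lt_trans yx) // -lt0n.
Qed.

(** The geometric series is integrated with an explicit remainder [I J]: consecutive remainders
    differ by the integral of a monomial, so the partial sums telescope, and the remainder decays
    geometrically. *)
Lemma cvg_series_Rintegral (R : realType) (k m : nat) (x : R) :
  (0 < k)%N -> 0 < x < 1 ->
  (fun J : nat => \sum_(j < J) x ^+ (k * j + m.+1) / (k * j + m.+1)%:R) @ \oo -->
  \int[lebesgue_measure]_(y in `[0, x]) (y ^+ m / (1 - y ^+ k)).
Proof.
move=> k0 x01; have /andP[x0 x1] := x01.
pose I (J : nat) : R := \int[lebesgue_measure]_(y in `[0, x]) (y ^+ (k * J + m) / (1 - y ^+ k)).
have yk y : y \in `[0, x] -> y ^+ k < 1.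
  by rewrite in_itv /= => /andP[y0 yx]; rewrite exprn_ilt1 ?(le_lt_trans yx) // -lt0n.
have step J : I J = x ^+ (k * J + m.+1) / (k * J + m.+1)%:R + I J.+1.
  apply/eqP; rewrite -subr_eq -RintegralB //; [|exact: geometric_kernel_integrable..].
  rewrite addnS -Rintegral_monomial //; apply/eqP/eq_Rintegral => y /set_mem /yk y1.
  have -> : (k * J.+1 + m = k + (k * J + m))%N by lia.
  rewrite (exprD _ k); move: (y ^+ k) y1 (y ^+ (k * J + m)) => t t1 A.
  by field; rewrite subr_eq0 eq_sym lt_eqF.
have sumE J : \sum_(j < J) x ^+ (k * j + m.+1) / (k * j + m.+1)%:R = I 0%N - I J.
  elim: J => [|J IH]; first by rewrite big_ord0 subrr.
  by rewrite big_ord_recr /= IH (step J); lra.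
under eq_cvg do rewrite sumE.
have -> : \int[lebesgue_measure]_(y in `[0, x]) (y ^+ m / (1 - y ^+ k)) = I 0%N - 0.
  by rewrite subr0 /I muln0.
apply: cvgB; first exact: cvg_cst.
(* On the interval, [y ^+ (k * J + m)] is at most [(x ^+ k) ^+ J * y ^+ m]. *)
have I0 J : 0 <= I J <= I 0%N * (x ^+ k) ^+ J.
  apply/andP; split.
    apply: Rintegral_ge0 => y xy; have /= := xy; rewrite in_itv /= => /andP[y0 _].
    by rewrite divr_ge0 ?exprn_ge0 // subr_ge0 ltW // yk.
  rewrite mulrC -RintegralZl //; last exact: geometric_kernel_integrable.
  apply: le_Rintegral => //; first exact: geometric_kernel_integrable.
    exact: (integrableZl _ _ (geometric_kernel_integrable _ k0 x01)).
  move=> y xy; have /= := xy; rewrite in_itv /= => /andP[y0 yx].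
  rewrite mulrA ler_wpM2r ?invr_ge0 ?subr_ge0 ?(ltW (yk y _)) //.
  by rewrite muln0 add0n exprD exprM ler_wpM2r ?exprn_ge0 // lerXn2r ?nnegrE ?exprn_ge0 ?(ltW x0) // lerXn2r ?nnegrE // ltW.
apply: (@squeeze_cvgr _ _ _ _ (fun=> 0) (fun J => I 0%N * (x ^+ k) ^+ J)).
- by near=> J; apply: I0.
- exact: cvg_cst.
- rewrite -(mulr0 (I 0%N)); apply: cvgMl_tmp.
  by apply: cvg_expr; rewrite ger0_norm ?exprn_ge0 ?(ltW x0) // exprn_ilt1 ?(ltW x0) // -lt0n.
Unshelve. all: by end_near.
Qed.

Lemma cvg_series_ln (R : realType) (x : R) : 0 < x < 1 ->
  (fun J : nat => \sum_(j < J) x ^+ j.+1 / j.+1%:R) @ \oo --> - ln (1 - x).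
Proof.
move=> x01; rewrite -Rintegral_inv_onem //.
have := @cvg_series_Rintegral R 1 0 x isT x01.
under eq_cvg do under eq_bigr do rewrite mul1n addn1.
by under eq_Rintegral do rewrite expr0 div1r expr1.
Qed.

Lemma cvg_sum_seq (R : realType) (I : Type) (r : seq I) (P : pred I)
  (f : I -> nat -> R) (a : I -> R) :
  (forall i, P i -> f i @ \oo --> a i) ->
  (fun n => \sum_(i <- r | P i) f i n) @ \oo --> \sum_(i <- r | P i) a i.
Proof. by move=> fa; apply: cvg_big => //; exact: add_continuous. Qed.

(** * Limiting probabilities of the types, and of success *)

Definition prob (R : realType) (n k : nat) (A : {set word n k}) : R :=
  #|A|%:R / #|arrangements n k|%:R.

Lemma cvg_inv_mul_nat (R : realType) (k : nat) : (0 < k)%N ->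
  (fun n : nat => (k * n)%:R^-1 : R) @ \oo --> (0 : R).
Proof.
move=> k0; rewrite -cvg_shiftS /=.
apply: (@squeeze_cvgr _ _ _ _ (fun=> 0) (@harmonic R)).
- near=> n; rewrite /harmonic invr_ge0 ler0n /= lef_pV2 ?posrE ?ltr0n ?muln_gt0 ?k0 //.
  by rewrite ler_nat leq_pmull.
- exact: cvg_cst.
- exact: cvg_harmonic.
Unshelve. all: by end_near.
Qed.

(* Real form of the ratio of successive level sizes: [v] is [1 / (k n)], [u] is [M / (k n)]. *)
Definition level_ratio (R : realType) (k j i : nat) (u v : R) : R :=
  ((k - i)%:R * (u - i%:R * v)) /
  (i.+1%:R * (1 - (k * j.+1)%:R * v - u + i.+1%:R * v)).

Section Limits.
Context (R : realType) (k : nat) (c : R) (M : nat -> nat).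
Hypothesis k0 : (0 < k)%N.
Hypothesis c01 : 0 < c < 1.
Hypothesis HM : forall n : nat, (1 <= n)%N -> (1 <= M n <= k * n - 1)%N.
Hypothesis Mc : (fun n : nat => ((M n)%:R / (k * n)%:R : R)) @ \oo --> c.

Let u (n : nat) : R := (M n)%:R / (k * n)%:R.
Let v (n : nat) : R := (k * n)%:R^-1.
Let v0 : v @ \oo --> (0 : R). Proof. exact: cvg_inv_mul_nat. Qed.
Let x : R := 1 - c.
Let x0 : 0 < x. Proof. by case/andP: c01 => _ c1; rewrite subr_gt0. Qed.

Let MN (n : nat) : (0 < n)%N -> (M n <= k * n)%N.
Proof. by move=> /HM; lia. Qed.

Definition rho (j l n : nat) : R := \prod_(i < l) level_ratio k j i (u n) (v n).

(** Ratio of the binomial probabilities, with parameters [k] and [c], of [l] successes and of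
    none. *)
Definition odds (l : nat) : R := 'C(k, l)%:R * (c / x) ^+ l.

Let cvg_denom (j i : nat) :
  (fun n => 1 - (k * j.+1)%:R * v n - u n + i.+1%:R * v n) @ \oo --> x.
Proof.
have -> : x = 1 - (k * j.+1)%:R * 0 - c + i.+1%:R * 0 by rewrite /x; ring.
by apply: cvgD; [apply: cvgB => //; apply: cvgB; [exact: cvg_cst|exact: cvgMl_tmp]|exact: cvgMl_tmp].
Qed.

Let cvg_num (i : nat) : (fun n => u n - i%:R * v n) @ \oo --> c.
Proof. by rewrite -[c]subr0 -[X in c - X](mulr0 i%:R); apply: cvgB => //; exact: cvgMl_tmp. Qed.

Lemma cvg_rho (j l : nat) : (l <= k)%N -> rho j l @ \oo --> odds l.
Proof.
elim: l => [|l IH] lk.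
  rewrite /odds bin0 expr0 mulr1.
  by under eq_cvg do rewrite /rho big_ord0; exact: cvg_cst.
(* The new factor is the limit of [level_ratio] at [i = l], where [v] tends to 0 and [u] to [c]. *)
have -> : odds l.+1 = odds l * ((k - l)%:R * c / (l.+1%:R * x)).
  have lne : l.+1%:R != 0 :> R by rewrite pnatr_eq0.
  have binE : 'C(k, l.+1)%:R = 'C(k, l)%:R * (k - l)%:R / l.+1%:R :> R.
    by apply: (mulIf lne); rewrite mulfVK // -!natrM mulnC mul_bin_left mulnC.
  by rewrite /odds binE exprSr; field; rewrite lt0r_neq0 //= addrC natr1.
rewrite /rho; under eq_cvg do rewrite big_ord_recr /=.
apply: cvgM; first exact: (IH (ltnW lk)).
rewrite /level_ratio; apply: cvgM; first by apply: cvgMl_tmp.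
apply: cvgV; first by rewrite mulf_neq0 ?pnatr_eq0 // lt0r_neq0.
by apply: cvgMl_tmp.
Unshelve. all: by end_near.
Qed.

(** Ranks start at 0, so rank [n - j.+1] has exactly [j] ranks above it: [alpha j l] is the
    probability of type [(j, l)], and [beta j] that of the top [j] ranks being late. *)
Let alpha (j l n : nat) : R := prob R (level n k (M n) (n - j.+1) l).
Let beta (j n : nat) : R := prob R (below_set n k (M n) (n - j)).

(** Induction on [l]: level 0 is [beta j.+1], and each further level contributes the ratio given by
    [level_step]. The equality is claimed for large [n] only, where the denominators are positive
    and the natural subtractions are not truncated. *)
Lemma alpha_rho (j l : nat) :
  \forall n \near \oo, alpha j l n = rho j l n * beta j.+1 n.
Proof.
elim: l => [|l IH].
  by near=> n; rewrite /alpha /beta level0 /rho big_ord0 mul1r.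
(* The limits [x] and [c] are positive, hence so are the two sequences eventually; this yields [r1]
   and [lM] below. *)
have D := cvgr_gt x (@cvg_denom j l) 0 x0.
have c0 : 0 < c by case/andP: c01.
have E := cvgr_gt c (@cvg_num l.+1) 0 c0.
near=> n; rewrite /rho big_ord_recr /= mulrAC.
have <- : alpha j l n = rho j l n * beta j.+1 n by near: n.
have jn : (j.+1 < n)%N by near: n; exists j.+2.
have n0 : (0 < n)%N by lia.
have kn0 : (0 : R) < (k * n)%:R by rewrite ltr0n muln_gt0 k0.
have d0 : 0 < 1 - (k * j.+1)%:R * v n - u n + l.+1%:R * v n.
  near: n; exact: D.
have e0 : 0 < u n - l.+1%:R * v n.
  near: n; exact: E.
have uE : (M n)%:R = (k * n)%:R * u n by rewrite /u mulrC mulfVK // lt0r_neq0.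
have vE : 1 = (k * n)%:R * v n by rewrite /v divff // lt0r_neq0.
have lM : (l.+1 < M n)%N.
  by have := mulr_gt0 kn0 e0; rewrite mulrBr -uE mulrCA -vE mulr1 subr_gt0 ltr_nat.
have dE : (k * n)%:R * (1 - (k * j.+1)%:R * v n - u n + l.+1%:R * v n) =
    (k * n)%:R - (k * j.+1)%:R - (M n)%:R + l.+1%:R :> R.
  by rewrite uE !mulrDr !mulrN ![(k * n)%:R * (_ * v n)]mulrCA -vE !mulr1.
have jk : (k * j.+1 <= k * n)%N by rewrite leq_mul2l (ltnW jn) orbT.
have r1 : (M n < k * n - k * j.+1 + l.+1)%N.
  by have := mulr_gt0 kn0 d0; rewrite dE -(ltr_nat R) natrD natrB //; lra.
have rE : (k * (n - j.+1) - (M n - l.+1))%:R =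
    (k * n)%:R * (1 - (k * j.+1)%:R * v n - u n + l.+1%:R * v n) :> R.
  rewrite mulnBr natrB; last by rewrite leq_subLR addnC ltnW.
  by rewrite !natrB ?(ltnW lM) // dE; lra.
have MlE : (M n - l)%:R = (k * n)%:R * (u n - l%:R * v n) :> R.
  by rewrite natrB ?(leq_trans _ lM) ?leqnSn ?leqW // mulrBr -uE mulrCA -vE mulr1.
have := @level_step n k (M n) (n - j.+1) l; rewrite ltn_subrL /= n0 MN // => /(_ isT isT).
move/(congr1 (fun z => z%:R : R)); rewrite !natrM rE MlE /alpha /prob /level_ratio.
set a := #|level n k (M n) (n - j.+1) l.+1|%:R; set b := #|level n k (M n) (n - j.+1) l|%:R.
set t := #|arrangements n k|%:R.
move=> Eab.
have tne : t != 0 by rewrite pnatr_eq0 -lt0n arrangements_gt0.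
apply: (mulIf tne); rewrite divfK // mulrAC divfK // mulrA.
have dd : l.+1%:R * (1 - (k * j.+1)%:R * v n - u n + l.+1%:R * v n) != 0.
  by rewrite mulf_neq0 ?pnatr_eq0 // lt0r_neq0.
apply: (mulIf dd); rewrite mulfVK //.
apply: (mulIf (lt0r_neq0 kn0)); move: Eab; set D' := 1 - _ - _ + _.
by move=> Eab; transitivity (a * (l.+1%:R * ((k * n)%:R * D'))); [ring|rewrite Eab; ring].
Unshelve. all: by end_near.
Qed.

Lemma below_set_full (n m : nat) : below_set n k m n = arrangements n k.
Proof.
apply/setP => s; rewrite mem_below_set andb_idr // => _.
by apply/forallP => i; rewrite ltn_ord implybT.
Qed.

Lemma prob_full (n : nat) : prob R (arrangements n k) = 1.
Proof. by rewrite /prob divff // pnatr_eq0 -lt0n arrangements_gt0. Qed.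

Lemma prob_split (n j : nat) (E : pred (word n k)) : (j < n)%N ->
  prob R [set s in below_set n k (M n) (n - j) | E s]%SET =
  \sum_(l < k.+1) prob R [set s in level n k (M n) (n - j.+1) l | E s]%SET.
Proof.
move=> jn; have -> : (n - j = (n - j.+1).+1)%N by lia.
by rewrite /prob below_set_split ?natr_sum ?mulr_suml //; lia.
Qed.

Lemma beta_split (j : nat) :
  \forall n \near \oo, beta j n = \sum_(l < k.+1) alpha j l n.
Proof.
near=> n; have jn : (j < n)%N by near: n; exists j.+1.
have setT_in (A : {set word n k}) : [set s in A | predT s]%SET = A.
  by apply/setP => s; rewrite inE andbT.
by have := prob_split predT jn; rewrite setT_in; under eq_bigr do rewrite setT_in.
Unshelve. all: by end_near.
Qed.

(** Binomial theorem, with [c / x + 1 = 1 / x]. *)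
Lemma sum_odds : \sum_(l < k.+1) odds l = (x ^+ k)^-1.
Proof.
have xne := lt0r_neq0 x0.
have -> : (x ^+ k)^-1 = (c / x + 1) ^+ k.
  by rewrite -exprVn; congr (_ ^+ _); rewrite /x; field; exact: xne.
by rewrite exprD1n; apply: eq_bigr => l _; rewrite /odds mulr_natl.
Qed.

(** Summing [alpha_rho] over [l] gives [beta j] as the sum of the [rho j l] times [beta j.+1];
    dividing by that sum, whose limit is the inverse of [x ^+ k], gives the induction step. *)
Lemma cvg_beta (j : nat) : beta j @ \oo --> (x ^+ k) ^+ j.
Proof.
have xk : (x ^+ k)^-1 != 0 by rewrite invr_eq0 expf_neq0 // lt0r_neq0.
elim: j => [|j IH].
  rewrite expr0; under eq_cvg do rewrite /beta subn0 below_set_full prob_full.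
  exact: cvg_cst.
have cS : (fun n => \sum_(l < k.+1) rho j l n) @ \oo --> (x ^+ k)^-1.
  rewrite -sum_odds; apply: cvg_sum_seq => l _.
  by apply: cvg_rho; rewrite -ltnS.
have S0 := cvgr_neq0 _ cS xk.
have A : \forall n \near \oo, forall l : 'I_k.+1, alpha j l n = rho j l n * beta j.+1 n.
  by apply: filter_forall => l; exact: alpha_rho.
have B := beta_split j.
rewrite exprSr -[X in _ * X]invrK.
apply: cvg_trans (cvgM IH (cvgV xk cS)); apply: near_eq_cvg; near=> n => /=.
have -> : beta j n = (\sum_(l < k.+1) rho j l n) * beta j.+1 n.
  rewrite big_distrl /=; have -> : beta j n = \sum_(l < k.+1) alpha j l n by near: n.
  by apply: eq_bigr => l _; move: l; near: n.
by rewrite mulrAC mulfV ?mul1r //; near: n; exact: S0.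
Unshelve. all: by end_near.
Qed.

Let sigma (j l n : nat) : R :=
  prob R [set s in level n k (M n) (n - j.+1) l | selects_top (M n) s]%SET.
Let residue (j n : nat) : R :=
  prob R [set s in below_set n k (M n) (n - j) | selects_top (M n) s]%SET.

(** For [l > 0], the probability of success given type [(j, l)]. With [j = 0] every candidate has
    top rank, so the only failure is [l = k], where no candidate is left. *)
Definition select_weight (j l : nat) : R :=
  if j == 0%N then (l < k)%:R else k%:R / (k * j.+1 - l)%:R.

Lemma sigma_alpha (j l : nat) : (0 < l <= k)%N ->
  \forall n \near \oo, sigma j l n = select_weight j l * alpha j l n.
Proof.
move=> /andP[l0 lk]; near=> n.
have jn : (j < n)%N by near: n; exists j.+1.
have n0 : (0 < n)%N by lia.
have rn : (n - j.+1 < n)%N by lia.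
have := level_select rn (MN n0) l0.
have -> : (n - (n - j.+1) = j.+1)%N by lia.
have -> : ((n - j.+1).+1 == n) = (j == 0%N) by apply/eqP/eqP; lia.
rewrite /sigma /alpha /select_weight /prob mulrA.
have [jk|jk] := boolP ((j == 0%N) && (l == k)).
  have /andP[/eqP -> /eqP ->] := jk.
  by rewrite level_full_select ?MN // ?cards0 ?ltnn ?mul0r //; lia.
have dpos : (0 < k * j.+1 - l)%N.
  by move: jk; case: (j) => [|i] /= jk; rewrite ?muln1 ?subn_gt0 ?mulnS; move/eqP: jk; nia.
move=> /(congr1 (fun z => z%:R : R)); rewrite !natrM => E.
congr (_ / _); have dne : (k * j.+1 - l)%:R != 0 :> R by rewrite pnatr_eq0 -lt0n.
apply: (mulIf dne); rewrite E; move: jk dne; case: eqP => [->|_] /= jk dne.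
  have lk' : (l < k)%N by rewrite ltn_neqAle jk.
  by rewrite muln1 lk' mul1r.
by rewrite mulrAC divfK // mulrC.
Unshelve. all: by end_near.
Qed.

(** The sum starts at [l = 1] because words with [l = 0] have a lower early maximum and are counted
    under a larger [j]. *)
Definition limit_term (j : nat) : R :=
  \sum_(1 <= l < k.+1) select_weight j l * (odds l * (x ^+ k) ^+ j.+1).

Lemma cvg_sigma (j l : nat) : (0 < l <= k)%N ->
  sigma j l @ \oo --> select_weight j l * (odds l * (x ^+ k) ^+ j.+1).
Proof.
move=> lk; have lk' : (l <= k)%N by case/andP: lk.
have A := alpha_rho j l; have S := sigma_alpha j lk.
apply: cvg_trans (cvgMl_tmp (cvgM (@cvg_rho j l lk') (@cvg_beta j.+1))).
apply: near_eq_cvg; near=> n => /=.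
have -> : sigma j l n = select_weight j l * alpha j l n by near: n.
by congr (_ * _); near: n; apply: filterS A => n ->.
Unshelve. all: by end_near.
Qed.

(** Level 0 of the split of [residue J] is [residue J.+1], so iterating the split peels off the
    types one rank at a time. *)
Lemma Psucc_expansion (J n : nat) : (J <= n)%N ->
  Psucc R n k (M n) = \sum_(j < J) \sum_(1 <= l < k.+1) sigma j l n + residue J n.
Proof.
have -> : Psucc R n k (M n) = residue 0 n by rewrite /residue subn0 below_set_full.
elim: J => [|J IH] Jn; first by rewrite big_ord0 add0r.
rewrite IH ?(ltnW Jn) // big_ord_recr /= -addrA; congr (_ + _).
rewrite /residue prob_split // -(big_mkord xpredT (fun l => sigma J l n)) big_ltn //.
by rewrite addrC /sigma level0.
Qed.

Lemma residue_bounds (J n : nat) : 0 <= residue J n <= beta J n.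
Proof.
rewrite /residue /beta /prob divr_ge0 ?ler0n //= ler_wpM2r ?invr_ge0 ?ler0n // ler_nat.
by apply: subset_leq_card; apply/fintype.subsetP => s; rewrite inE => /andP[].
Qed.

Lemma cvg_Psucc (L : R) :
  (fun J => \sum_(j < J) limit_term j) @ \oo --> L ->
  (fun n => Psucc R n k (M n)) @ \oo --> L.
Proof.
move=> AL; apply/cvgrPdist_lt => e e0.
have e3 : 0 < e / 3 by rewrite divr_gt0.
have x1 : x < 1 by rewrite /x; case/andP: c01; lra.
have xk : `|x ^+ k| < 1.
  by rewrite ger0_norm ?exprn_ge0 ?(ltW x0) // exprn_ilt1 ?(ltW x0) // -lt0n.
(* [J] is fixed before [n]: it controls the tail of the limit series and the limit of [beta J],
   which bounds the residue. The remaining third of [e] is for the convergence of finitely many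
   [sigma] terms. *)
have [J [J1 J2]] : exists J, `|L - \sum_(j < J) limit_term j| < e / 3 /\ (x ^+ k) ^+ J < e / 3.
  have H1 := cvgr_dist_lt _ _ AL _ e3.
  have H2 := cvgr_lt _ (cvg_expr xk) _ e3.
  have [J _ HJ] := filterI (H1 _) (H2 _).
  by exists J; apply: (HJ J) => /=.
have cS : (fun n => \sum_(j < J) \sum_(1 <= l < k.+1) sigma j l n) @ \oo -->
    \sum_(j < J) limit_term j.
  apply: cvg_sum_seq => j _; rewrite /limit_term; under eq_cvg do rewrite big_nat_cond.
  by rewrite big_nat_cond; apply: cvg_sum_seq => l /andP[lk _]; exact: cvg_sigma.
have S1 := cvgr_dist_lt _ _ cS _ e3.
have B1 := cvgr_lt _ (@cvg_beta J) _ J2.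
near=> n.
rewrite (@Psucc_expansion J n); last by near: n; exists J.
have /andP[r0 rb] := residue_bounds J n.
have b1 : beta J n < e / 3 by near: n; exact: B1.
have s1 : `|\sum_(j < J) limit_term j - \sum_(j < J) \sum_(1 <= l < k.+1) sigma j l n| < e / 3.
  by near: n; exact: S1.
move: s1 J1; rewrite !ltr_norml; lra.
Unshelve. all: by end_near.
Qed.

End Limits.

(** * Summation over the rank of the maximum, and the closed form *)

Lemma cvg_level_series (R : realType) (k l : nat) (c : R) :
  (0 < l < k)%N -> 0 < c < 1 ->
  (fun J => \sum_(j < J) select_weight R k j l * (odds k c l * ((1 - c) ^+ k) ^+ j.+1)) @ \oo -->
  - (1 - c) ^+ k * ('C(k, l)%:R * (c / (1 - c)) ^+ l * (l%:R / (k - l)%:R)) +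
  k%:R * ('C(k, l)%:R * c ^+ l *
    Rintegral lebesgue_measure `[0, 1 - c] (fun y : R => y ^+ (k - l - 1) / (1 - y ^+ k))).
Proof.
move=> /andP[l0 lk] /andP[c0 c1]; set x := 1 - c.
have x01 : 0 < x < 1 by apply/andP; split; rewrite /x; lra.
have xne : x != 0 by case/andP: x01 => ? _; rewrite lt0r_neq0.
have k0 : (0 < k)%N by lia.
have klE : (k - l - 1).+1 = (k - l)%N by lia.
have klne : (k - l)%:R != 0 :> R by rewrite pnatr_eq0; lia.
have oddsE i : (l <= i)%N -> (c / x) ^+ l * x ^+ i = c ^+ l * x ^+ (i - l).
  move=> li; rewrite expr_div_n -{1}(subnK li) exprD; move: (x ^+ (i - l)) => t.
  by field; rewrite expf_neq0.
have H := @cvg_series_Rintegral R k (k - l - 1) x k0 x01.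
set I := Rintegral _ _ _ in H *.
pose a : R := 'C(k, l)%:R * c ^+ l.
have -> : - x ^+ k * ('C(k, l)%:R * (c / x) ^+ l * (l%:R / (k - l)%:R)) + k%:R * (a * I) =
    a * x ^+ (k - l) * (1 - k%:R / (k - l)%:R) + k%:R * a * I.
  have kE : k%:R = (k - l)%:R + l%:R :> R by rewrite -natrD subnK // ltnW.
  have -> : - x ^+ k * ('C(k, l)%:R * (c / x) ^+ l * (l%:R / (k - l)%:R)) =
      - ('C(k, l)%:R * ((c / x) ^+ l * x ^+ k) * (l%:R / (k - l)%:R)) by ring.
  rewrite oddsE ?(ltnW lk) // /a kE; move: (c ^+ l) (x ^+ _) => s t.
  by field.
rewrite -cvg_shiftS /=.
(* At [j = 0] the weight is 1 and not the general [k / (k - l)]. Correcting this one term gives the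
   constant, whose factor [1 - k / (k - l)] equals [- l / (k - l)]; the series that remains is the
   one of the integral. *)
have E J : \sum_(j < J.+1) select_weight R k j l * (odds k c l * (x ^+ k) ^+ j.+1) =
    a * x ^+ (k - l) * (1 - k%:R / (k - l)%:R) + k%:R * a *
    \sum_(j < J.+1) x ^+ (k * j + (k - l - 1).+1) / (k * j + (k - l - 1).+1)%:R.
  rewrite !big_ord_recl /= klE muln0 add0n mulrDr.
  rewrite {1}/select_weight /= lk mul1r /odds expr1 -mulrA oddsE ?(ltnW lk) // mulrA -/a.
  have -> : \sum_(i < J) select_weight R k (bump 0 i) l * (odds k c l * (x ^+ k) ^+ (bump 0 i).+1) =
      k%:R * a * \sum_(i < J) x ^+ (k * bump 0 i + (k - l)) / (k * bump 0 i + (k - l))%:R.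
    rewrite big_distrr /=; apply: eq_bigr => i _; rewrite /bump leq0n add1n /select_weight /=.
    rewrite /odds -exprM -/x -mulrA oddsE; last by nia.
    have -> : (k * i.+2 - l = k * i.+1 + (k - l))%N by nia.
    by rewrite /a; ring.
  by ring.
under eq_cvg do rewrite E.
apply: cvgD; first exact: cvg_cst.
apply: cvgMl_tmp.
by have := H; rewrite -cvg_shiftS.
Qed.

(** For [l = k] the term [j = 0] vanishes and the weight at [j > 0] is [1 / j], which leaves the
    logarithmic series at [(1 - c) ^+ k]. *)
Lemma cvg_full_level_series (R : realType) (k : nat) (c : R) :
  (0 < k)%N -> 0 < c < 1 ->
  (fun J => \sum_(j < J) select_weight R k j k * (odds k c k * ((1 - c) ^+ k) ^+ j.+1)) @ \oo -->
  - (c ^+ k * ln (1 - (1 - c) ^+ k)).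
Proof.
move=> k0 /andP[c0 c1]; set x := 1 - c.
have x0 : 0 < x by rewrite /x; lra.
have xk : 0 < x ^+ k < 1.
  by rewrite exprn_gt0 //= exprn_ilt1 ?(ltW x0) -?lt0n //; rewrite /x; lra.
rewrite -cvg_shiftS /= -mulrN.
have E J : \sum_(j < J.+1) select_weight R k j k * (odds k c k * (x ^+ k) ^+ j.+1) =
    c ^+ k * \sum_(j < J) (x ^+ k) ^+ j.+1 / j.+1%:R.
  rewrite big_ord_recl /= {1}/select_weight /= ltnn mul0r add0r big_distrr /=.
  apply: eq_bigr => j _; rewrite /bump leq0n add1n /select_weight /= /odds binn -/x.
  have -> : (k * j.+2 - k = k * j.+1)%N by nia.
  have kne : k%:R != 0 :> R by rewrite pnatr_eq0 -lt0n.
  have jne : j.+1%:R != 0 :> R by rewrite pnatr_eq0.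
  have xne : x ^+ k != 0 by rewrite lt0r_neq0 //; case/andP: xk.
  rewrite natrM exprS expr_div_n; move: (x ^+ k) xne => t tne.
  by field; rewrite kne tne addrC natr1 jne.
under eq_cvg do rewrite E.
by apply: cvgMl_tmp; exact: cvg_series_ln.
Qed.

Theorem theorem1 (R : realType) (k : nat) (c : R) (M : nat -> nat) :
  (2 <= k)%N -> 0 < c < 1 ->
  (forall n : nat, (1 <= n)%N -> (1 <= M n <= k * n - 1)%N) ->
  (fun n : nat => ((M n)%:R / (k * n)%:R : R)) @ \oo --> c ->
  (fun n : nat => Psucc R n k (M n)) @ \oo -->
    (- (1 - c) ^+ k *
        \sum_(1 <= l < k) 'C(k, l)%:R * (c / (1 - c)) ^+ l * (l%:R / (k - l)%:R)
     + k%:R * \sum_(1 <= l < k) 'C(k, l)%:R * c ^+ l *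
         Rintegral lebesgue_measure `[0, 1 - c]
           (fun y : R => y ^+ (k - l - 1) / (1 - y ^+ k))
     - c ^+ k * ln (1 - (1 - c) ^+ k)).
Proof.
move=> k2 c01 HM Mc; have k0 : (0 < k)%N by exact: ltnW.
apply: (cvg_Psucc k0 c01 HM Mc).
(* Each [l] is summed over [j] separately; [l = k] is split off and produces the logarithm. *)
rewrite /limit_term; under eq_cvg do rewrite exchange_big /= big_nat_recr //=.
apply: cvgD; last exact: cvg_full_level_series.
rewrite !big_distrr -big_split /=; under eq_cvg do rewrite big_nat_cond.
rewrite big_nat_cond; apply: cvg_sum_seq => l /andP[lk _].
exact: cvg_level_series.
Qed.
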